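(* Let $S=\mathbb{F}_q[C_0,C_1,C_0^*,C_1^*,U_{-1},U_0,U_1]$ be a polynomial ring in seven variables and let $\pi:S\to \mathbb{F}_q[x_1,x_2,y_1,y_2]^{\mathrm{GL}_2(\mathbb{F}_q)}$ be the surjective $\mathbb{F}_q$-algebra homomorphism with $C_i\mapsto c_i$, $C_i^*\mapsto c_i^*$ ($i=0,1$) and $U_j\mapsto u_j$ ($j=-1,0,1$). Let $\mathcal{I}\subseteq S$ be the ideal generated by the five polynomials $$C_0U_{-1}-C_1U_0^q+U_1^q,\qquad C_0^*U_1-C_1^*U_0^q+U_{-1}^q,\qquad C_0C_0^*-(U_{-1}U_1-U_0^{q+1})^{q-1},$$ $$C_1C_0^*-C_1^*U_1^{q-1}-U_{-1}U_0\sum_{i=1}^{q-1}(-1)^i\binom{q-1}{i}(U_{-1}U_1)^{q-1-i}U_0^{(q+1)(i-1)},$$ $$C_0C_1^*-C_1U_{-1}^{q-1}-U_0U_1\sum_{i=1}^{q-1}(-1)^i\binom{q-1}{i}(U_{-1}U_1)^{q-1-i}U_0^{(q+1)(i-1)}.$$ Then $\ker(\pi)=\mathcal{I}$.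
   Context: $\mathbb{F}_q$ is the finite field with $q=p^m$ elements; $\mathrm{GL}_2(\mathbb{F}_q)$ acts on $V\oplus V^*$ with $V=\mathbb{F}_q^2$, and $\mathbb{F}_q[V\oplus V^*]=\mathbb{F}_q[x_1,x_2,y_1,y_2]$ where $x_1,x_2$ is a basis of $V^*$ dual to the basis $y_1,y_2$ of $V$, with the induced (diagonal) action. Let $*$ be the $\mathbb{F}_q$-algebra involution with $x_1\mapsto y_2$, $x_2\mapsto y_1$, $y_1\mapsto x_2$, $y_2\mapsto x_1$. Define $d_2:=x_1x_2^q-x_2x_1^q$, $d_1:=x_1x_2^{q^2}-x_2x_1^{q^2}$, $c_0:=d_2^{q-1}$, $c_1:=d_1/d_2$, and $c_0^*,c_1^*$ their $*$-images; $u_0:=x_1y_1+x_2y_2$, $u_1:=x_1^qy_1+x_2^qy_2$, $u_{-1}:=x_1y_1^q+x_2y_2^q$. It is known that $c_0,c_1,c_0^*,c_1^*,u_{-1},u_0,u_1$ generate the invariant ring $\mathbb{F}_q[x_1,x_2,y_1,y_2]^{\mathrm{GL}_2(\mathbb{F}_q)}$, so $\pi$ is surjective. *)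

(* Defs.v *)
From HB Require Import structures.
From mathcomp Require Import all_boot all_order all_algebra all_field.
From mathcomp Require Import mpoly.
Set Implicit Arguments. Unset Strict Implicit. Unset Printing Implicit Defensive.
Import GRing.Theory.
Local Open Scope ring_scope.

Section GL2Invariants.
Variable F : finFieldType.

Definition qF : nat := #|F|.

Definition P4 := {mpoly F[4]}.
Definition x1 : P4 := 'X_(inord 0).
Definition x2 : P4 := 'X_(inord 1).
Definition y1 : P4 := 'X_(inord 2).
Definition y2 : P4 := 'X_(inord 3).

Definition star (p : P4) : P4 := comp_mpoly [tuple y2; y1; x2; x1] p.

Definition d2 : P4 := x1 * x2 ^+ qF - x2 * x1 ^+ qF.
Definition d1 : P4 := x1 * x2 ^+ (qF ^ 2) - x2 * x1 ^+ (qF ^ 2).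
Definition c0 : P4 := d2 ^+ (qF - 1).
Definition u0 : P4 := x1 * y1 + x2 * y2.
Definition u1 : P4 := x1 ^+ qF * y1 + x2 ^+ qF * y2.
Definition um1 : P4 := x1 * y1 ^+ qF + x2 * y2 ^+ qF.

Definition S7 := {mpoly F[7]}.
Definition C0 : S7 := 'X_(inord 0).
Definition C1 : S7 := 'X_(inord 1).
Definition C0s : S7 := 'X_(inord 2).
Definition C1s : S7 := 'X_(inord 3).
Definition Um1 : S7 := 'X_(inord 4).
Definition U0 : S7 := 'X_(inord 5).
Definition U1 : S7 := 'X_(inord 6).

(* pi : S -> F[x1,x2,y1,y2] (landing in the invariant ring), given
   c1 = d1/d2 and c1* = (d1/d2)^* *)
Definition pi_map (c1 c1s : P4) (f : S7) : P4 :=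
  comp_mpoly [tuple c0; c1; star c0; c1s; um1; u0; u1] f.

Definition sumterm : S7 :=
  \sum_(1 <= i < qF) ((-1) ^+ i * ('C(qF - 1, i))%:R) *:
     ((Um1 * U1) ^+ (qF - 1 - i) * U0 ^+ ((qF + 1) * (i - 1))).

Definition gen_rel (i : 'I_5) : S7 :=
  match val i with
  | 0 => C0 * Um1 - C1 * U0 ^+ qF + U1 ^+ qF
  | 1 => C0s * U1 - C1s * U0 ^+ qF + Um1 ^+ qF
  | 2 => C0 * C0s - (Um1 * U1 - U0 ^+ (qF + 1)) ^+ (qF - 1)
  | 3 => C1 * C0s - C1s * U1 ^+ (qF - 1) - Um1 * U0 * sumterm
  | _ => C0 * C1s - C1 * Um1 ^+ (qF - 1) - U0 * U1 * sumterm
  end.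

Definition in_rel_ideal (f : S7) : Prop :=
  exists a : 'I_5 -> S7, f = \sum_(i < 5) a i * gen_rel i.

End GL2Invariants.

(* Main.v *)
Require Import Defs.
From mathcomp Require Import all_boot all_order all_algebra all_field.
From mathcomp Require Import fingroup pgroup abelian mpoly ring zify.
Set Implicit Arguments. Unset Strict Implicit. Unset Printing Implicit Defensive.
Import GRing.Theory.
Local Open Scope ring_scope.

(* The five generators [r0, ..., r4], together with [Um1 r4 - C1s r0], rewrite the
   products [C0 Um1], [C0s U1], [C0 C0s], [C1 C0s], [C0 C1s] and [C1 Um1^q] into
   lighter monomials for a suitable weight, so every polynomial is congruent modulo the
   ideal to a combination of normal monomials, those divisible by none of the six.
   Restricting to the cone [u0 = 0], parametrised by [y = b (- x2, x1)], sends
   [c0, c1, c0*, c1*, um1, u1] up to sign to monomials in the algebraically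
   independent elements [b], [d2], [c1], and distinct normal monomials free of [U0]
   have distinct images. Hence a normal polynomial in the kernel is divisible by
   [U0]; since [u0] is not a zero divisor the quotient is again normal and in the
   kernel, so by iteration the polynomial vanishes. *)

(** * The field size as a power of the characteristic *)

Lemma qF_gt1 (F : finFieldType) : (1 < qF F)%N.
Proof. exact: finNzRing_gt1. Qed.

(** The additive group of a finite field is elementary abelian, so [qF F] is a power of the
    characteristic. This makes [a ^+ q] additive in [a]. *)
Lemma pnat_qF (F : finFieldType) (A : lalgType F) : [pchar A].-nat (qF F).
Proof.
have p_pr : prime (pdiv (qF F)) by rewrite pdiv_prime ?qF_gt1.
have /abelem_pgroup := finField_is_abelem F.
rewrite /pgroup cardsT -/(qF F) => pF.
have /p_natP[n oF] := pF.
have pcharF : pdiv (qF F) \in [pchar F] by apply: card_finPcharP oF _.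
by rewrite (eq_pnat _ (pchar_lalg A)) (eq_pnat _ (pcharf_eq pcharF)).
Qed.

Lemma qF_pred (F : finFieldType) : exists r, qF F = r.+2.
Proof. by have := qF_gt1 F; case: (qF F) => [|[|r]] // _; exists r. Qed.

(** * Leading monomials *)

(** Both terms have total degree [k + 1]; the tie is decided at the smaller index [i], where the
    exponents are [1] and [k]. *)
Lemma mlead_moore (R : idomainType) n (i j : 'I_n) k : (i < j)%N -> (1 < k)%N ->
  mlead ('X_i * 'X_j ^+ k - 'X_j * 'X_i ^+ k : {mpoly R[n]}) = (U_(j) + U_(i) *+ k)%MM.
Proof.
move=> ltij k_gt1; rewrite !mpolyXn -!mpolyXD mleadDr mleadN ?mleadXm //.
apply/ltmcP; first by rewrite !mdegD !mdegMn !mdeg1.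
exists i; last first.
  rewrite !mnmDE !mulmnE !mnm1E eqxx -!(inj_eq val_inj) /= (gtn_eqF ltij).
  by rewrite mul0n mul1n.
move=> l ltli; rewrite !mnmDE !mulmnE !mnm1E -!(inj_eq val_inj) /=.
by rewrite !(gtn_eqF ltli) (gtn_eqF (ltn_trans ltli ltij)).
Qed.

Lemma moore_neq0 (R : idomainType) n (i j : 'I_n) k : (i < j)%N -> (1 < k)%N ->
  'X_i * 'X_j ^+ k - 'X_j * 'X_i ^+ k != 0 :> {mpoly R[n]}.
Proof.
move=> ltij k_gt1; apply/eqP => /(congr1 (@mlead _ _)).
rewrite mlead_moore // mlead0 => /eqP.
by rewrite mnmD_eq0 mnm1_eq0.
Qed.

Lemma mpolyX_neq0 (R : idomainType) n (m : 'X_{1..n}) : 'X_[m] != 0 :> {mpoly R[n]}.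
Proof. by rewrite -msupp_eq0 msuppX. Qed.

(** Distinct leading monomials cannot cancel. The second conjunct carries the induction: it
    separates the leading monomial of the tail from that of the new summand. *)
Lemma mlead_sum_distinct (R : idomainType) n (I : eqType) (s : seq I)
    (G : I -> {mpoly R[n]}) :
    s != [::] -> {in s, forall i, G i != 0} -> uniq [seq mlead (G i) | i <- s] ->
  (\sum_(i <- s) G i != 0) &&
  (mlead (\sum_(i <- s) G i) \in [seq mlead (G i) | i <- s]).
Proof.
elim: s => // i s IHs _ nzG /= /andP[Gi_notin Us].
have nzGi : G i != 0 by apply: nzG; rewrite mem_head.
rewrite big_cons; have [-> | s_n0] := eqVneq s [::].
  by rewrite big_nil addr0 nzGi mem_head.
have /andP[nzS S_in] : _ := IHs s_n0 (fun j js => nzG j (mem_behead (s := i :: s) js)) Us.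
move: nzS S_in; set S := \sum_(j <- s) G j => nzS S_in.
have neq : mlead (G i) != mlead S by apply: contraNneq Gi_notin => ->.
apply/andP; split.
  by apply: contraNneq neq => /eqP; rewrite addr_eq0 => /eqP ->; rewrite mleadN.
rewrite mleadD // inE; case: Order.TotalTheory.leP => _.
  by rewrite S_in orbT.
by rewrite eqxx.
Qed.

(** * The relations *)

Section Relations.
Variable F : finFieldType.
Local Notation q := (qF F).

Lemma mpoly_exprDq n (a b : {mpoly F[n]}) : (a + b) ^+ q = a ^+ q + b ^+ q.
Proof. exact/exprDn_pchar/pnat_qF. Qed.

Lemma mpoly_exprNq n (a : {mpoly F[n]}) : (- a) ^+ q = - a ^+ q.
Proof. exact/exprNn_pchar/pnat_qF. Qed.

(** Binomial expansion: the term of index 0 is subtracted, and all others share the factor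
    [U0 ^+ (q + 1)]. *)
Lemma sumtermE :
  sumterm F * U0 F ^+ (q + 1) =
  (Um1 F * U1 F - U0 F ^+ (q + 1)) ^+ (q - 1) - (Um1 F * U1 F) ^+ (q - 1).
Proof.
rewrite exprBn big_ord_recl /= subn0 bin0 expr0 mul1r mulr1 mulr1n addrC addKr.
rewrite /sumterm mulr_suml big_add1 big_mkord.
have -> : q.-1 = (q - 1)%N by lia.
apply: eq_bigr => i _; rewrite /bump /= add1n subSS subn0.
rewrite -scalerAl -mulrA -!mulrA -exprD -exprM.
have -> : ((q + 1) * i + (q + 1) = (q + 1) * i.+1)%N by lia.
rewrite -scalerA scaler_nat -[in LHS]signr_odd scaler_sign.
by rewrite -[in RHS]signr_odd mulr_sign; case: (odd _); rewrite ?mulNrn.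
Qed.

(* [d ^+ q] is computed by the Frobenius endomorphism, after which the three-term
   relation is the expansion of a 3x3 determinant with two equal rows. *)
Lemma moore_three_term n (a b c d : {mpoly F[n]}) :
    d = a * b ^+ q - b * a ^+ q -> c * d = a * b ^+ (q ^ 2) - b * a ^+ (q ^ 2) ->
    d != 0 ->
  (a ^+ (q ^ 2) = c * a ^+ q - d ^+ (q - 1) * a) *
  (b ^+ (q ^ 2) = c * b ^+ q - d ^+ (q - 1) * b).
Proof.
move=> dE cdE d_neq0.
have dq : d ^+ (q - 1) * d = a ^+ q * b ^+ (q ^ 2) - b ^+ q * a ^+ (q ^ 2).
  rewrite -exprSr subn1 prednK ?(ltnW (qF_gt1 F)) // dE.
  by rewrite mpoly_exprDq mpoly_exprNq !exprMn -!exprM mulnn.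
have expand e : (c * e ^+ q - d ^+ (q - 1) * e) * d =
    (c * d) * e ^+ q - (d ^+ (q - 1) * d) * e.
  by rewrite mulrBl mulrAC (mulrAC (d ^+ _)).
split; apply: (mulIf d_neq0); rewrite expand cdE dq dE.
  by move: (a ^+ q) (b ^+ q) (a ^+ (q ^ 2)) (b ^+ (q ^ 2)) => *; ring.
by move: (a ^+ q) (b ^+ q) (a ^+ (q ^ 2)) (b ^+ (q ^ 2)) => *; ring.
Qed.

Lemma inord_tupleE (m k : nat) (t : m.+1.-tuple {mpoly F[k]}) i :
  (i < m.+1)%N -> 'X_(inord i) \mPo t = t`_i.
Proof. by move=> lt_im; rewrite comp_mpolyXU inordK. Qed.

Lemma star_vars :
  (star (x1 F) = y2 F) * (star (x2 F) = y1 F) *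
  (star (y1 F) = x2 F) * (star (y2 F) = x1 F).
Proof. by rewrite /star !inord_tupleE. Qed.

Lemma star_d2 : star (d2 F) = y2 F * y1 F ^+ q - y1 F * y2 F ^+ q.
Proof. by rewrite /d2 {1}/star rmorphB !rmorphM !rmorphXn /= -!/(star _) !star_vars. Qed.

Lemma star_d1 : star (d1 F) = y2 F * y1 F ^+ (q ^ 2) - y1 F * y2 F ^+ (q ^ 2).
Proof. by rewrite /d1 {1}/star rmorphB !rmorphM !rmorphXn /= -!/(star _) !star_vars. Qed.

Lemma star_c0 : star (c0 F) = star (d2 F) ^+ (q - 1).
Proof. by rewrite /c0 /star rmorphXn. Qed.

Lemma d2_neq0 : d2 F != 0.
Proof. by apply: moore_neq0; rewrite ?inordK ?qF_gt1. Qed.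

Lemma star_d2_neq0 : star (d2 F) != 0.
Proof.
by rewrite star_d2 -oppr_eq0 opprB; apply: moore_neq0; rewrite ?inordK ?qF_gt1.
Qed.

Lemma u0_neq0 : u0 F != 0.
Proof.
rewrite /u0 /x1 /x2 /y1 /y2 -!mpolyXD addr_eq0 -scaleN1r.
apply/eqP => /(congr1 (mcoeff (U_(inord 0) + U_(inord 2)))).
rewrite mcoeffZ !mcoeffX eqxx.
case: eqP => [/mnmP/(_ (inord 0))|_ /eqP]; last by rewrite mulr0 oner_eq0.
by rewrite !mnmDE !mnm1E -!(inj_eq val_inj) /= !inordK.
Qed.

Section Pi.
Variables c1 c1s : P4 F.
Local Notation pi := (pi_map c1 c1s).

Lemma pi_vars :
  (pi (C0 F) = c0 F) * (pi (C1 F) = c1) * (pi (C0s F) = star (c0 F)) *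
  (pi (C1s F) = c1s) * (pi (Um1 F) = um1 F) * (pi (U0 F) = u0 F) * (pi (U1 F) = u1 F).
Proof. by rewrite /pi_map !inord_tupleE. Qed.

Lemma um1_Frob : um1 F ^+ q = x1 F ^+ q * y1 F ^+ (q ^ 2) + x2 F ^+ q * y2 F ^+ (q ^ 2).
Proof. by rewrite mpoly_exprDq !exprMn -!exprM mulnn. Qed.

Lemma u1_Frob : u1 F ^+ q = x1 F ^+ (q ^ 2) * y1 F ^+ q + x2 F ^+ (q ^ 2) * y2 F ^+ q.
Proof. by rewrite mpoly_exprDq !exprMn -!exprM mulnn. Qed.

Lemma u0_Frob : u0 F ^+ q = x1 F ^+ q * y1 F ^+ q + x2 F ^+ q * y2 F ^+ q.
Proof. by rewrite mpoly_exprDq !exprMn. Qed.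

Hypothesis c1E : c1 * d2 F = d1 F.
Hypothesis c1sE : c1s * star (d2 F) = star (d1 F).

(** Multiply the three-term relation for each [x_i] by [y_i ^+ q] and add the two. *)
Lemma c1_u0q : c1 * u0 F ^+ q = c0 F * um1 F + u1 F ^+ q.
Proof.
have [x1E x2E] := moore_three_term (erefl (d2 F)) c1E d2_neq0.
rewrite u0_Frob u1_Frob x1E x2E /c0 /um1; move: (d2 F ^+ _) => D.
by move: (x1 F ^+ q) (x2 F ^+ q) (y1 F ^+ q) (y2 F ^+ q) => *; ring.
Qed.

Lemma c1s_u0q : c1s * u0 F ^+ q = star (c0 F) * u1 F + um1 F ^+ q.
Proof.
have := c1sE; rewrite star_d1 => c1sE'.
have [y1E y2E] := moore_three_term star_d2 c1sE' star_d2_neq0.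
rewrite u0_Frob um1_Frob y1E y2E star_c0 /u1; move: (star _ ^+ _) => D.
by move: (x1 F ^+ q) (x2 F ^+ q) (y1 F ^+ q) (y2 F ^+ q) => *; ring.
Qed.

(** The matrix with rows [(x1, x2)], [(x1^q, x2^q)] times the one with rows [(y1^q, y1)],
    [(y2^q, y2)] has rows [(um1, u0)], [(u0^q, u1)]. Taking determinants gives [d2 * star d2]. *)
Lemma c0_star_c0 : c0 F * star (c0 F) = (um1 F * u1 F - u0 F ^+ (q + 1)) ^+ (q - 1).
Proof.
rewrite star_c0 star_d2 -exprMn exprD expr1 u0_Frob /d2 /um1 /u1 /u0; congr (_ ^+ _).
by move: (x1 F ^+ q) (x2 F ^+ q) (y1 F ^+ q) (y2 F ^+ q) => *; ring.
Qed.

Lemma pi_sumterm :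
  pi (sumterm F) * (u0 F ^+ q * u0 F) =
  c0 F * star (c0 F) - um1 F ^+ (q - 1) * u1 F ^+ (q - 1).
Proof.
have := congr1 pi sumtermE.
rewrite /pi_map !(rmorphB, rmorphM, rmorphXn) -/(pi _) /= -!/(pi _) !pi_vars => E.
by rewrite c0_star_c0 -exprMn -E exprD expr1.
Qed.

Lemma exprq_pred (a : P4 F) : a ^+ q = a ^+ (q - 1) * a.
Proof. by rewrite -exprSr subn1 prednK ?(ltnW (qF_gt1 F)). Qed.

(** After multiplication by [u0 ^+ q], which can be cancelled, the first two relations eliminate
    [c1] and [c1s], and [pi_sumterm] absorbs the factor [u0 ^+ q * u0]. *)
Lemma c1_star_c0 : c1 * star (c0 F) =
  c1s * u1 F ^+ (q - 1) + um1 F * u0 F * pi (sumterm F).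
Proof.
apply: (mulIf (expf_neq0 q u0_neq0)).
transitivity ((c1 * u0 F ^+ q) * star (c0 F)); first by ring.
transitivity ((c1s * u0 F ^+ q) * u1 F ^+ (q - 1) +
   um1 F * (pi (sumterm F) * (u0 F ^+ q * u0 F))); last by ring.
rewrite c1_u0q c1s_u0q pi_sumterm !exprq_pred.
by move: (u1 F ^+ _) (um1 F ^+ _) => *; ring.
Qed.

Lemma c0_c1s : c0 F * c1s =
  c1 * um1 F ^+ (q - 1) + u0 F * u1 F * pi (sumterm F).
Proof.
apply: (mulIf (expf_neq0 q u0_neq0)).
transitivity ((c1s * u0 F ^+ q) * c0 F); first by ring.
transitivity ((c1 * u0 F ^+ q) * um1 F ^+ (q - 1) +
   u1 F * (pi (sumterm F) * (u0 F ^+ q * u0 F))); last by ring.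
rewrite c1_u0q c1s_u0q pi_sumterm !exprq_pred.
by move: (u1 F ^+ _) (um1 F ^+ _) => *; ring.
Qed.

Lemma pi_gen_rel i : pi (gen_rel F i) = 0.
Proof.
case: i => -[|[|[|[|[|//]]]]] lti; rewrite /gen_rel /= /pi_map;
  rewrite !(rmorphB, rmorphD, rmorphM, rmorphXn) /= -!/(pi_map c1 c1s _) !pi_vars.
- by rewrite c1_u0q; ring.
- by rewrite c1s_u0q; ring.
- by rewrite c0_star_c0; ring.
- by rewrite c1_star_c0; ring.
- by rewrite c0_c1s; ring.
Qed.

Lemma pi_ideal f : in_rel_ideal f -> pi f = 0.
Proof.
case=> a ->; rewrite /pi_map rmorph_sum big1 // => i _.
by rewrite rmorphM /= -[X in _ * X]/(pi _) pi_gen_rel mulr0.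
Qed.

End Pi.

End Relations.

(** * Reduction to normal monomials *)

Section WeightedDegree.
Variables (R : idomainType) (n : nat) (w : 'I_n -> nat).
Implicit Types (p r : {mpoly R[n]}) (m : 'X_{1..n}) (d e : nat).

Definition mnm_weight m := (\sum_i m i * w i)%N.

Lemma mnm_weightD m1 m2 : mnm_weight (m1 + m2) = (mnm_weight m1 + mnm_weight m2)%N.
Proof.
by rewrite -big_split /=; apply: eq_bigr => i _; rewrite mnmDE mulnDl.
Qed.

Lemma mnm_weightMn m k : mnm_weight (m *+ k) = (mnm_weight m * k)%N.
Proof.
by rewrite big_distrl /=; apply: eq_bigr => i _; rewrite mulmnE mulnAC.
Qed.

Lemma mnm_weightU i : mnm_weight U_(i) = w i.
Proof.
rewrite /mnm_weight (bigD1 i) //= mnm1E eqxx mul1n big1 ?addn0 // => j ne_ji.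
by rewrite mnm1E eq_sym (negbTE ne_ji).
Qed.

Definition weight_le d p := forall m, m \in msupp p -> (mnm_weight m <= d)%N.

Lemma weight_leW d e p : (d <= e)%N -> weight_le d p -> weight_le e p.
Proof. by move=> le_de le_pd m /le_pd le_md; apply: leq_trans le_de. Qed.

Lemma weight_le0 d : weight_le d 0.
Proof. by move=> m; rewrite msupp0. Qed.

Lemma weight_leD d p r : weight_le d p -> weight_le d r -> weight_le d (p + r).
Proof. by move=> lep ler m /msuppD_le; rewrite mem_cat => /orP[/lep|/ler]. Qed.

Lemma weight_leN d p : weight_le d p -> weight_le d (- p).
Proof. by move=> lep m; rewrite (perm_mem (msuppN p)) => /lep. Qed.

Lemma weight_leZ d c p : weight_le d p -> weight_le d (c *: p).
Proof. by move=> lep m /msuppZ_le/lep. Qed.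

Lemma weight_leM d e p r :
  weight_le d p -> weight_le e r -> weight_le (d + e) (p * r).
Proof.
move=> lep ler m /msuppM_le/allpairsP[[m1 m2] /= [/lep le1 /ler le2 ->]].
by rewrite mnm_weightD leq_add.
Qed.

Lemma weight_leX d p k : weight_le d p -> weight_le (d * k) (p ^+ k).
Proof.
move=> lep; elim: k => [|k IHk]; last by rewrite exprS mulnS; apply: weight_leM.
move=> m; rewrite expr0 msupp1 inE => /eqP ->.
by rewrite /mnm_weight big1 // => i _; rewrite mnm0E.
Qed.

Lemma weight_leU i : weight_le (w i) 'X_i.
Proof. by move=> m; rewrite msuppX inE => /eqP ->; rewrite mnm_weightU. Qed.

Lemma weight_le_sum (I : Type) (s : seq I) (P : pred I) (G : I -> {mpoly R[n]}) d :
  (forall i, P i -> weight_le d (G i)) -> weight_le d (\sum_(i <- s | P i) G i).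
Proof.
move=> leG; elim/big_ind: _ => //; [exact: weight_le0|exact: weight_leD].
Qed.

End WeightedDegree.

(** * Rewriting modulo the ideal *)

Section Reduction.
Variable F : finFieldType.
Local Notation q := (qF F).
Implicit Types (f g : S7 F) (m : 'X_{1..7}).

Lemma in_rel_ideal0 : in_rel_ideal (0 : S7 F).
Proof. by exists (fun=> 0); rewrite big1 // => i _; rewrite mul0r. Qed.

Lemma in_rel_idealD f g : in_rel_ideal f -> in_rel_ideal g -> in_rel_ideal (f + g).
Proof.
move=> [a ->] [b ->]; exists (fun i => a i + b i).
by rewrite -big_split /=; apply: eq_bigr => i _; rewrite mulrDl.
Qed.

Lemma in_rel_idealM f g : in_rel_ideal g -> in_rel_ideal (f * g).
Proof.
move=> [a ->]; exists (fun i => f * a i).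
by rewrite mulr_sumr; apply: eq_bigr => i _; rewrite mulrA.
Qed.

Lemma in_rel_ideal_gen i : in_rel_ideal (gen_rel F i).
Proof.
exists (fun j => (j == i)%:R); rewrite (bigD1 i) //= eqxx mul1r big1 ?addr0 //.
by move=> j /negbTE ->; rewrite mul0r.
Qed.

(* The indices 0, ..., 6 stand for C0, C1, C0s, C1s, Um1, U0, U1. *)
Definition normal m :=
  [&& (m (inord 0) == 0) || (m (inord 4) == 0),
      (m (inord 2) == 0) || (m (inord 6) == 0),
      (m (inord 0) == 0) || (m (inord 2) == 0),
      (m (inord 1) == 0) || (m (inord 2) == 0),
      (m (inord 0) == 0) || (m (inord 3) == 0) &
      (m (inord 1) == 0) || (m (inord 4) < q)]%N.

Definition normalizable f :=
  exists2 g, {in msupp g, forall m, normal m} & in_rel_ideal (f - g).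

Lemma normalizable_mod f g :
  in_rel_ideal (f - g) -> normalizable g -> normalizable f.
Proof.
move=> Ifg [h Nh Igh]; exists h => //.
by rewrite -(subrK g f) -addrA; apply: in_rel_idealD.
Qed.

Lemma normalizable0 : normalizable 0.
Proof.
by exists 0; rewrite ?subrr; [move=> m; rewrite msupp0|apply: in_rel_ideal0].
Qed.

Lemma normalizableD f g : normalizable f -> normalizable g -> normalizable (f + g).
Proof.
move=> [f' Nf If] [g' Ng Ig]; exists (f' + g').
  by move=> m /msuppD_le; rewrite mem_cat => /orP[/Nf|/Ng].
by rewrite opprD addrACA; apply: in_rel_idealD.
Qed.

Lemma normalizableZ c f : normalizable f -> normalizable (c *: f).
Proof.
move=> [f' Nf If]; exists (c *: f'); first by move=> m /msuppZ_le/Nf.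
by rewrite -scalerBr -mul_mpolyC; apply: in_rel_idealM.
Qed.

Lemma normalizable_supp f :
  (forall m, m \in msupp f -> normalizable 'X_[m]) -> normalizable f.
Proof.
move=> Nf; rewrite [f]mpolyE big_seq.
elim/big_ind: _ => [||m /Nf Nm]; [exact: normalizable0|exact: normalizableD|].
exact: normalizableZ.
Qed.

(* These weights make the left-hand side of each of the rewrite rules
   [C0 Um1], [C0s U1], [C0 C0s], [C1 C0s], [C1s C0] and [C1 Um1^q]
   heavier than every monomial of the corresponding right-hand side. *)
Definition var_weight (i : 'I_7) : nat := nth 0%N [:: 2 * q; q; 2 * q; 0; 1; 0; 1]%N i.

Lemma var_weight_inord i : (i < 7)%N ->
  var_weight (inord i) = nth 0%N [:: 2 * q; q; 2 * q; 0; 1; 0; 1]%N i.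
Proof. by move=> lti; rewrite /var_weight inordK. Qed.

Lemma weight_le_var i : (i < 7)%N ->
  weight_le var_weight (nth 0%N [:: 2 * q; q; 2 * q; 0; 1; 0; 1]%N i) ('X_(inord i) : S7 F).
Proof. by move=> lti; rewrite -var_weight_inord //; apply: weight_leU. Qed.

Lemma weight_le_sumterm : weight_le var_weight (2 * (q - 2)) (sumterm F).
Proof.
rewrite /sumterm big_nat; apply: weight_le_sum => i /andP[i_gt0 ltiq].
apply: weight_leZ; apply: weight_leW; last first.
  apply: weight_leM; apply: weight_leX; last exact: weight_le_var.
  apply: weight_leM; exact: weight_le_var.
by rewrite /=; lia.
Qed.

(** One rewriting step: the rule is multiplied by the cofactor of ['X_i * 'X_j ^+ e] in ['X_[m]],
    and all resulting monomials are lighter than [m]. *)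
Lemma normalizable_rewrite m (i j : 'I_7) e d (r : S7 F) :
    (forall m', (mnm_weight var_weight m' < mnm_weight var_weight m)%N ->
       normalizable 'X_[m']) ->
    i != j -> (0 < m i)%N -> (e <= m j)%N ->
    in_rel_ideal ('X_i * 'X_j ^+ e - r) -> weight_le var_weight d r ->
    (d < var_weight i + var_weight j * e)%N ->
  normalizable 'X_[m].
Proof.
move=> IHm ne_ij m_i m_j Ir le_rd lt_d.
set l := (U_(i) + U_(j) *+ e)%MM.
have le_lm : (l <= m)%MM.
  apply/mnm_lepP => k; rewrite mnmDE mulmnE !mnm1E.
  case: eqP => [<-|_]; first by rewrite eq_sym (negbTE ne_ij) addn0.
  by case: eqP => [<-|_]; rewrite ?mul1n ?mul0n.
have mE : m = (m - l + l)%MM by rewrite submK.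
have wm : mnm_weight var_weight m = (mnm_weight var_weight (m - l) +
    (var_weight i + var_weight j * e))%N.
  by rewrite {1}mE !mnm_weightD mnm_weightMn !mnm_weightU.
apply: (@normalizable_mod _ ('X_[m - l] * r)).
  rewrite {1}mE mpolyXD mpolyXD -mpolyXn -mulrBr; exact: in_rel_idealM.
apply: normalizable_supp => m' m'_in; apply: IHm.
have le_X : weight_le var_weight (mnm_weight var_weight (m - l)) ('X_[m - l] : S7 F).
  by move=> m2; rewrite msuppX inE => /eqP ->.
by apply: leq_ltn_trans (weight_leM le_X le_rd m'_in) _; rewrite wm ltn_add2l.
Qed.

(** The rules for [C0 * Um1] and [C0 * C1s] overlap in [C0 * C1s * Um1]; comparing the two
    reductions yields this sixth rule. Giving [C1s] weight 0 makes [C1s * U1 ^+ q] lighter than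
    [C1 * Um1 ^+ q]. *)
Lemma in_rel_ideal_C1Um1q :
  in_rel_ideal (C1 F * Um1 F ^+ q - (C1 F * C1s F * U0 F ^+ q - C1s F * U1 F ^+ q
    - U0 F * U1 F * Um1 F * sumterm F)).
Proof.
have q_gt0 : (0 < q)%N by rewrite ltnW ?qF_gt1.
have -> : Um1 F ^+ q = Um1 F ^+ (q - 1) * Um1 F by rewrite -exprSr subn1 prednK.
have := in_rel_idealD (in_rel_idealM (- Um1 F) (in_rel_ideal_gen (inord 4)))
  (in_rel_idealM (C1s F) (in_rel_ideal_gen (inord 0))).
rewrite /gen_rel /= !inordK //; congr in_rel_ideal; ring.
Qed.

Local Ltac weigh :=
  apply: weight_leW; last by repeat first
    [apply: weight_le_sumterm | apply: weight_leM | apply: weight_leX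
    | apply: weight_le_var].

Lemma normalizableX m : normalizable 'X_[m].
Proof.
have q_gt1 := qF_gt1 F.
move: {2}(mnm_weight _ m).+1 (ltnSn (mnm_weight var_weight m)) => k.
elim: k m => // k IHk m; rewrite ltnS => le_mk.
have {k IHk le_mk} IHm m' : (mnm_weight var_weight m' < mnm_weight var_weight m)%N ->
    normalizable 'X_[m'].
  by move=> lt_m'm; apply: IHk; apply: leq_trans le_mk.
have gen := in_rel_ideal_gen.
have [Nm|] := boolP (normal m).
  exists 'X_[m]; last by rewrite subrr; apply: in_rel_ideal0.
  by move=> m'; rewrite msuppX inE => /eqP ->.
(* Each violated clause says that the left-hand side of one of the six rules divides [m]. *)
rewrite !negb_and !negb_or -leqNgt -!lt0n => /or4P[|||/or3P[]] /andP[mi mj].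
- apply: (@normalizable_rewrite m (inord 0) (inord 4) 1 q
    (C1 F * U0 F ^+ q - U1 F ^+ q)) => //.
  + by rewrite -(inj_eq val_inj) /= !inordK.
  + rewrite -/(C0 F) -/(Um1 F); have := gen (inord 0).
    by rewrite /gen_rel /= inordK //; congr in_rel_ideal; ring.
  + apply: weight_leD; last apply: weight_leN; (weigh; rewrite /=; lia).
  + by rewrite !var_weight_inord //=; lia.
- apply: (@normalizable_rewrite m (inord 2) (inord 6) 1 q
    (C1s F * U0 F ^+ q - Um1 F ^+ q)) => //.
  + by rewrite -(inj_eq val_inj) /= !inordK.
  + rewrite -/(C0s F) -/(U1 F); have := gen (inord 1).
    by rewrite /gen_rel /= inordK //; congr in_rel_ideal; ring.
  + apply: weight_leD; last apply: weight_leN; (weigh; rewrite /=; lia).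
  + by rewrite !var_weight_inord //=; lia.
- apply: (@normalizable_rewrite m (inord 0) (inord 2) 1 (2 * (q - 1))
    ((Um1 F * U1 F - U0 F ^+ (q + 1)) ^+ (q - 1))) => //.
  + by rewrite -(inj_eq val_inj) /= !inordK.
  + by have := gen (inord 2); rewrite /gen_rel /= inordK.
  + apply: weight_leX; apply: weight_leD; last apply: weight_leN; (weigh; rewrite /=; lia).
  + by rewrite !var_weight_inord //=; lia.
- apply: (@normalizable_rewrite m (inord 1) (inord 2) 1 (2 * q)
    (C1s F * U1 F ^+ (q - 1) + Um1 F * U0 F * sumterm F)) => //.
  + by rewrite -(inj_eq val_inj) /= !inordK.
  + rewrite -/(C1 F) -/(C0s F); have := gen (inord 3).
    by rewrite /gen_rel /= inordK //; congr in_rel_ideal; ring.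
  + apply: weight_leD; (weigh; rewrite /=; lia).
  + by rewrite !var_weight_inord //=; lia.
(* The margin is exactly one here: [C1 * Um1 ^+ (q - 1)] weighs [2 * q - 1] against [2 * q]. *)
- apply: (@normalizable_rewrite m (inord 0) (inord 3) 1 (2 * q - 1)
    (C1 F * Um1 F ^+ (q - 1) + U0 F * U1 F * sumterm F)) => //.
  + by rewrite -(inj_eq val_inj) /= !inordK.
  + rewrite -/(C0 F) -/(C1s F); have := gen (inord 4).
    by rewrite /gen_rel /= inordK //; congr in_rel_ideal; ring.
  + apply: weight_leD; (weigh; rewrite /=; lia).
  + by rewrite !var_weight_inord //=; lia.
- apply: (normalizable_rewrite (d := 2 * q - 1) IHm _ mi mj in_rel_ideal_C1Um1q).
  + by rewrite -(inj_eq val_inj) /= !inordK.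
  + apply: weight_leD; last apply: weight_leN;
      first (apply: weight_leD; last apply: weight_leN); (weigh; rewrite /=; lia).
  + by rewrite !var_weight_inord //=; lia.
Qed.

Lemma normalizable_all f : normalizable f.
Proof. by apply: normalizable_supp => m _; apply: normalizableX. Qed.

End Reduction.

(** * Restriction to the cone u0 = 0 *)

(* With [t = q - 1], the three equations compare the exponents of [b], [d2], [c1]
   in the toric images of two normal monomials. *)
Lemma normal_toric_inj (t a0 a1 a2 a3 a4 a6 b0 b1 b2 b3 b4 b6 : nat) : (0 < t)%N ->
  [&& (a0 == 0) || (a4 == 0), (a2 == 0) || (a6 == 0), (a0 == 0) || (a2 == 0),
      (a1 == 0) || (a2 == 0), (a0 == 0) || (a3 == 0) & (a1 == 0) || (a4 < t.+1)]%N ->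
  [&& (b0 == 0) || (b4 == 0), (b2 == 0) || (b6 == 0), (b0 == 0) || (b2 == 0),
      (b1 == 0) || (b2 == 0), (b0 == 0) || (b3 == 0) & (b1 == 0) || (b4 < t.+1)]%N ->
  (t.+2 * t * a2 + t.+1 * t * a3 + t.+1 * a4 + a6 =
   t.+2 * t * b2 + t.+1 * t * b3 + t.+1 * b4 + b6)%N ->
  (t * (a0 + a2) + a4 + a6 = t * (b0 + b2) + b4 + b6)%N ->
  (a1 + a3 = b1 + b3)%N ->
  [/\ a0 = b0, a1 = b1 & a2 = b2] /\ [/\ a3 = b3, a4 = b4 & a6 = b6].
Proof.
move=> t_gt0 Na Nb eqB eqD eqG.
(* The [b] equation minus the [d2] equation is divisible by [t]; [a6] and [b6] drop out. *)
have eqN : (t.+1 * (a2 + a3) + a4 + b0 = t.+1 * (b2 + b3) + b4 + a0)%N.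
  clear Na Nb; apply/eqP; rewrite -(eqn_pmul2l t_gt0); apply/eqP; nia.
(* Eliminating [a3] and [b3] from [eqN] by means of [eqG]. *)
have eqM : (t.+1 * a1 + a0 + t.+1 * b2 + b4 = t.+1 * b1 + b0 + t.+1 * a2 + a4)%N.
  clear Na Nb eqB; nia.
clear eqB; have [a0_0|a0_gt0] := posnP a0; have [b0_0|b0_gt0] := posnP b0; last 1 first.
- have [? [? ?]] : (a2 = 0 /\ a3 = 0 /\ a4 = 0)%N by lia.
  have [? [? ?]] : (b2 = 0 /\ b3 = 0 /\ b4 = 0)%N by lia.
  subst; clear Na Nb eqM.
  have eq0 : a0 = b0 by lia.
  by subst; split; split; lia.
- subst; have [a1_0|a1_gt0] := posnP a1; have [b1_0|b1_gt0] := posnP b1; last 1 first.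
  + have a2_0 : (a2 = 0)%N by lia.
    have b2_0 : (b2 = 0)%N by lia.
    have lt_a4 : (a4 < t.+1)%N by lia.
    have lt_b4 : (b4 < t.+1)%N by lia.
    subst; clear Na Nb eqN.
    (* Uniqueness of Euclidean division by [t.+1], with [a4] and [b4] as remainders. *)
    have a1b1 : (a1 = b1)%N.
      by case: (ltngtP a1 b1) => // ?; exfalso; nia.
    by subst; split; split; lia.
  + have e : (a2 + b6 = b2 + a6)%N by clear Na Nb eqN; subst; nia.
    have ? : (a2 = b2)%N by lia.
    by subst; clear Na Nb; split; split; lia.
  + have b2_0 : (b2 = 0)%N by lia.
    have lt_b4 : (b4 < t.+1)%N by lia.
    by clear Na Nb eqN; exfalso; subst; nia.
  + have a2_0 : (a2 = 0)%N by lia.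
    have lt_a4 : (a4 < t.+1)%N by lia.
    by clear Na Nb eqN; exfalso; subst; nia.
(* A positive [b0] forces [b2 = b3 = b4 = 0], so one side of [eqN] is zero while the other contains
   [b0]. The last case is symmetric. *)
- by exfalso; clear eqM eqD; lia.
- by exfalso; clear eqM eqD; lia.
Qed.

Section Toric.
Variable F : finFieldType.
Local Notation q := (qF F).

Lemma big_ord7 (R : Type) (idx : R) (op : Monoid.law idx) (G : 'I_7 -> R) :
  \big[op/idx]_i G i = op (G (inord 0)) (op (G (inord 1)) (op (G (inord 2))
    (op (G (inord 3)) (op (G (inord 4)) (op (G (inord 5)) (G (inord 6))))))).
Proof.
rewrite !big_ord_recl big_ord0 Monoid.mulm1.
by do !congr (op _ _); congr G; apply: val_inj; rewrite /= ?inordK.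
Qed.

Lemma mnm7P (m m' : 'X_{1..7}) :
  (forall k, (k < 7)%N -> m (inord k) = m' (inord k)) -> m = m'.
Proof. by move=> eqm; apply/mnmP => i; rewrite -(inord_val i) eqm. Qed.

(* The isotropic cone [u0 = 0] is parametrised by [y = b (- x2, x1)]; the
   variable [y1] of the target plays the role of [b]. *)
Definition psi (p : P4 F) : P4 F :=
  comp_mpoly [tuple x1 F; x2 F; - (y1 F * x2 F); y1 F * x1 F] p.

Lemma psi_vars :
  (psi (x1 F) = x1 F) * (psi (x2 F) = x2 F) *
  (psi (y1 F) = - (y1 F * x2 F)) * (psi (y2 F) = y1 F * x1 F).
Proof. by rewrite /psi !inord_tupleE. Qed.

Lemma psiB p r : psi (p - r) = psi p - psi r.
Proof. exact: rmorphB. Qed.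

Lemma psiD p r : psi (p + r) = psi p + psi r.
Proof. exact: rmorphD. Qed.

Lemma psiM p r : psi (p * r) = psi p * psi r.
Proof. exact: rmorphM. Qed.

Lemma psiX p n : psi (p ^+ n) = psi p ^+ n.
Proof. exact: rmorphXn. Qed.

Lemma psi_u0 : psi (u0 F) = 0.
Proof. by rewrite /u0 !(psiB, psiD, psiM, psiX) !psi_vars; ring. Qed.

Lemma psi_u1 : psi (u1 F) = y1 F * d2 F.
Proof.
rewrite /u1 !(psiB, psiD, psiM, psiX) !psi_vars /d2.
by move: (x1 F ^+ q) (x2 F ^+ q) => *; ring.
Qed.

Lemma psi_um1 : psi (um1 F) = - (y1 F ^+ q * d2 F).
Proof.
rewrite /um1 !(psiB, psiD, psiM, psiX) !psi_vars /d2 mpoly_exprNq !exprMn.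
by move: (x1 F ^+ q) (x2 F ^+ q) (y1 F ^+ q) => *; ring.
Qed.

Lemma psi_d2 : psi (d2 F) = d2 F.
Proof. by rewrite /d2 !(psiB, psiD, psiM, psiX) !psi_vars. Qed.

Lemma psi_d1 : psi (d1 F) = d1 F.
Proof. by rewrite /d1 !(psiB, psiD, psiM, psiX) !psi_vars. Qed.

Lemma psi_star_d2 : psi (star (d2 F)) = - (y1 F ^+ q.+1 * d2 F).
Proof.
rewrite star_d2 !(psiB, psiD, psiM, psiX) !psi_vars /d2 mpoly_exprNq !exprMn exprS.
by move: (x1 F ^+ q) (x2 F ^+ q) (y1 F ^+ q) => *; ring.
Qed.

Lemma psi_star_d1 : psi (star (d1 F)) = - (y1 F ^+ (q ^ 2).+1 * d1 F).
Proof.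
rewrite star_d1 !(psiB, psiD, psiM, psiX) !psi_vars /d1.
have -> : (- (y1 F * x2 F)) ^+ (q ^ 2) = - (y1 F * x2 F) ^+ (q ^ 2).
  by rewrite -mulnn !exprM !mpoly_exprNq.
rewrite !exprMn exprS.
by move: (x1 F ^+ _) (x2 F ^+ _) (y1 F ^+ _) => *; ring.
Qed.

Lemma psi_star_c0 :
  psi (star (c0 F)) = (-1) ^+ (q - 1) * (y1 F ^+ (q.+1 * (q - 1)) * d2 F ^+ (q - 1)).
Proof.
rewrite star_c0 /psi rmorphXn /= -/(psi _) psi_star_d2.
by rewrite (exprNn (y1 F ^+ q.+1 * _)) exprMn -exprM.
Qed.

(** * Toric images of monomials and their leading terms *)

Section WithC1.
Variables c1 c1s : P4 F.
Hypothesis c1E : c1 * d2 F = d1 F.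
Hypothesis c1sE : c1s * star (d2 F) = star (d1 F).
Local Notation pi := (pi_map c1 c1s).

Lemma psi_c1 : psi c1 = c1.
Proof.
apply: (mulIf (d2_neq0 F)); rewrite c1E -{1}psi_d2 -psi_d1 -c1E.
by rewrite /psi rmorphM.
Qed.

(** [c1s] is known only through its product with [star d2], whose image is nonzero and can be
    cancelled; the exponent of [b] is [(q ^ 2 + 1) - (q + 1)]. *)
Lemma psi_c1s : psi c1s = y1 F ^+ (q ^ 2 - q) * c1.
Proof.
have nz : - (y1 F ^+ q.+1 * d2 F) != 0.
  by rewrite oppr_eq0 mulf_neq0 ?expf_neq0 ?mpolyX_neq0 ?d2_neq0.
apply: (mulIf nz); rewrite -{1}psi_star_d2.
transitivity (psi (star (d1 F))); first by rewrite -c1sE /psi rmorphM.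
rewrite psi_star_d1 -c1E.
have -> : (q ^ 2).+1 = (q ^ 2 - q + q.+1)%N by have := qF_gt1 F; nia.
by rewrite exprD; ring.
Qed.

Definition toric_b (m : 'X_{1..7}) : nat :=
  (q.+1 * (q - 1) * m (inord 2) + (q ^ 2 - q) * m (inord 3)
   + q * m (inord 4) + m (inord 6))%N.
Definition toric_d (m : 'X_{1..7}) : nat :=
  ((q - 1) * (m (inord 0) + m (inord 2)) + m (inord 4) + m (inord 6))%N.
Definition toric_c (m : 'X_{1..7}) : nat := (m (inord 1) + m (inord 3))%N.

(** The power of [psi (u0 F)] is left unevaluated so that one formula covers both cases: it is 1
    when [U0] is absent and 0 otherwise. *)
Lemma psi_pi_X m :
  psi (pi 'X_[m]) =
    (psi (u0 F)) ^+ m (inord 5) * ((-1) ^+ ((q - 1) * m (inord 2) + m (inord 4)) *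
      (y1 F ^+ toric_b m * d2 F ^+ toric_d m * c1 ^+ toric_c m)).
Proof.
rewrite /pi_map comp_mpolyX big_ord7 /= !(tnth_nth 0) /= !inordK //=.
rewrite !psiM !psiX psi_d2 psi_c1 psi_star_c0 psi_c1s psi_um1 psi_u1.
rewrite (exprNn (y1 F ^+ q * _)) !exprMn -!exprM /toric_b /toric_d /toric_c !exprD.
rewrite mulnDr exprD.
move: (psi (u0 F) ^+ _) => U; ring.
Qed.

Lemma c1_neq0 : c1 != 0.
Proof.
apply/eqP => c1_0; have := c1E; rewrite c1_0 mul0r => /esym/eqP; apply/negP.
apply: moore_neq0; first by rewrite !inordK.
by rewrite (leq_trans (qF_gt1 F)) // -mulnn leq_pmulr // ltnW ?qF_gt1.
Qed.

(** Leading monomials multiply in [c1 * d2 = d1]. Hence [c1] has leading monomial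
    [x1 ^ (q ^ 2 - q)]. *)
Lemma mlead_c1D : (mlead c1 + (U_(inord 1) + U_(inord 0) *+ q) =
  U_(inord 1) + U_(inord 0) *+ q ^ 2)%MM.
Proof.
have q2_gt1 : (1 < q ^ 2)%N.
  by rewrite (leq_trans (qF_gt1 F)) // -mulnn leq_pmulr // ltnW ?qF_gt1.
have <- := @mlead_moore F 4 (inord 0) (inord 1) q.
- rewrite -mleadM ?c1_neq0 ?d2_neq0 //.
  have := congr1 (@mlead _ _) c1E; rewrite /d1 mlead_moore // ?inordK //.
- by rewrite !inordK.
- exact: qF_gt1.
Qed.

(** The exponents of [y1], [x2], [x1] depend on [b], [d], [c] in triangular fashion, so the leading
    monomial recovers all three; this is the algebraic independence of [b], [d2], [c1]. *)
Lemma mlead_toric b d c :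
  let l := mlead (y1 F ^+ b * d2 F ^+ d * c1 ^+ c) in
  [/\ l (inord 2) = b, l (inord 1) = d & (l (inord 0) = q * d + (q ^ 2 - q) * c)%N].
Proof.
have c1nz := c1_neq0; have d2nz := d2_neq0 F.
have y1nz : y1 F != 0 by apply: mpolyX_neq0.
rewrite /= !mleadM ?mulf_neq0 ?expf_neq0 // !mleadX // mleadXm.
have -> : mlead (d2 F) = (U_(inord 1) + U_(inord 0) *+ q)%MM.
  by apply: mlead_moore; rewrite ?inordK ?qF_gt1.
have c1L k := congr1 (fun l : 'X_{1..4} => l (inord k)) mlead_c1D.
have := c1L 0%N; have := c1L 1%N; have := c1L 2%N.
rewrite !mnmDE !mulmnE !mnmDE !mulmnE !mnm1E -!(inj_eq val_inj) /= !inordK //=.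
move: (mlead c1 (inord 0)) (mlead c1 (inord 1)) (mlead c1 (inord 2)) => l0 l1 l2.
move=> *; have := qF_gt1 F; split; nia.
Qed.

Lemma normal_mlead_inj (m m' : 'X_{1..7}) :
    normal F m -> normal F m' -> m (inord 5) = 0%N -> m' (inord 5) = 0%N ->
    mlead (psi (pi 'X_[m])) = mlead (psi (pi 'X_[m'])) -> m = m'.
Proof.
move=> Nm Nm' m5 m5'.
rewrite !psi_pi_X m5 m5' !expr0 !mul1r.
have leadS k (p : P4 F) : mlead ((-1) ^+ k * p) = mlead p.
  by rewrite -signr_odd mulr_sign; case: (odd _); rewrite ?mleadN.
rewrite !leadS => eql.
have [] := mlead_toric (toric_b m) (toric_d m) (toric_c m); rewrite eql.
have [-> -> ->] := mlead_toric (toric_b m') (toric_d m') (toric_c m').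
move=> eqb eqd; rewrite eqd => /eqP; rewrite eqn_add2l eqn_pmul2l; last first.
  by have := qF_gt1 F; nia.
move/eqP=> eqc.
move: Nm Nm' eqb eqd eqc; rewrite /normal /toric_b /toric_d /toric_c.
(* Writing [q = r.+2] puts the equations in the form of [normal_toric_inj] with [t = r.+1]. *)
have [r qE] := qF_pred F; rewrite qE.
have -> : (r.+2 - 1 = r.+1)%N by lia.
have -> : (r.+2 ^ 2 - r.+2 = r.+2 * r.+1)%N.
  by rewrite -mulnn -{3}[r.+2]muln1 -mulnBr subSS subn0.
move=> Nm Nm' eqb eqd eqc.
have [[e0 e1 e2] [e3 e4 e6]] :=
  normal_toric_inj (ltn0Sn r) Nm Nm' (esym eqb) (esym eqd) (esym eqc).
by apply: mnm7P => -[|[|[|[|[|[|[|//]]]]]]] _; rewrite // m5 m5'.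
Qed.

(** Under [psi] the monomials containing [U0] vanish; those left have distinct leading monomials, so
    their combination is zero only if there are none. *)
Lemma normal_ker_U0 f : {in msupp f, forall m, normal F m} -> pi f = 0 ->
  {in msupp f, forall m : 'X_{1..7}, 0 < m (inord 5)}%N.
Proof.
move=> Nf pif0 m0 m0_in; rewrite lt0n; apply/negP => /eqP m05.
pose s := [seq m : 'X_{1..7} <- msupp f | m (inord 5) == 0%N].
pose G m := psi (pi (f@_m *: 'X_[m])).
have GE m : G m = f@_m *: psi (pi 'X_[m]) by rewrite /G /psi /pi_map !comp_mpolyZ.
have nz_s m : m \in s -> psi (pi 'X_[m]) != 0.
  rewrite mem_filter psi_pi_X => /andP[/eqP -> _]; rewrite expr0 mul1r.
  rewrite mulf_neq0 ?signr_eq0 //.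
  by rewrite !mulf_neq0 ?expf_neq0 ?mpolyX_neq0 ?d2_neq0 ?c1_neq0.
have nzc m : m \in s -> f@_m != 0.
  by rewrite mem_filter => /andP[_]; rewrite mcoeff_msupp.
have s_n0 : s != [::].
  by apply/eqP => s0; have := in_nil m0; rewrite -s0 mem_filter m0_in m05.
have sum0 : \sum_(m <- s) G m = 0.
  rewrite big_filter; transitivity (psi (pi f)); last by rewrite pif0 /psi comp_mpoly0.
  have -> : psi (pi f) = \sum_(m <- msupp f) G m.
    rewrite {1}[f]mpolyE; apply: (big_morph (fun p => psi (pi p))) => [p r|].
      by rewrite /pi_map comp_mpolyD /psi comp_mpolyD.
    by rewrite /pi_map comp_mpoly0 /psi comp_mpoly0.
  rewrite [RHS](bigID (fun m : 'X_{1..7} => m (inord 5) == 0%N)) /=.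
  rewrite [X in _ = _ + X]big1 ?addr0 // => m m5.
  by rewrite -[LHS]/(G m) GE psi_pi_X psi_u0 expr0n (negbTE m5) mul0r scaler0.
have [] := andP (@mlead_sum_distinct _ _ _ s G s_n0 _ _).
- by move=> m ms; rewrite GE scaler_eq0 negb_or nzc ?nz_s.
- have -> : [seq mlead (G m) | m <- s] = [seq mlead (psi (pi 'X_[m])) | m <- s].
    by apply/eq_in_map => m ms; rewrite GE mleadZ ?nzc.
  rewrite map_inj_in_uniq ?filter_uniq ?msupp_uniq // => m m'.
  rewrite !mem_filter => /andP[/eqP m5 /Nf Nm] /andP[/eqP m5' /Nf Nm'].
  exact: normal_mlead_inj.
by rewrite sum0 eqxx.
Qed.

(** [normal] does not constrain the exponent of [U0], so division by [U0] preserves it; the kernel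
    condition survives because [u0] is nonzero in a domain. *)
Lemma normal_ker_divU0 f : {in msupp f, forall m, normal F m} -> pi f = 0 ->
  exists2 g, f = g * U0 F & {in msupp g, forall m, normal F m} /\ pi g = 0.
Proof.
move=> Nf pif0; have f5 := normal_ker_U0 Nf pif0.
(* The truncated subtraction is exact on the support, by [f5]. *)
pose g : S7 F := \sum_(m <- msupp f) f@_m *: 'X_[m - U_(inord 5)].
have fE : f = g * U0 F.
  rewrite {1}[f]mpolyE mulr_suml big_seq [RHS]big_seq; apply: eq_bigr => m /f5 m5.
  rewrite -scalerAl -mpolyXD submK //; apply/mnm_lepP => i; rewrite mnm1E.
  by case: eqP => // <-.
exists g => //; split; last first.
  apply: (mulIf (u0_neq0 F)); rewrite mul0r -pif0 fE /pi_map rmorphM /=.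
  by rewrite -!/(pi _) pi_vars.
move=> m; rewrite mcoeff_msupp -(mcoeffMX g U_(inord 5)) -[_ * _]fE -mcoeff_msupp.
by move/Nf; rewrite /normal !mnmDE !mnm1E -!(inj_eq val_inj) /= !inordK.
Qed.

Lemma normal_ker f : {in msupp f, forall m, normal F m} -> pi f = 0 -> f = 0.
Proof.
move=> Nf pif0; apply: msuppnil0; apply/eqP; rewrite -[_ == _]negbK; apply/negP.
have U0_ge k : {in msupp f, forall m : 'X_{1..7}, k <= m (inord 5)}%N.
  elim: k f Nf pif0 => // k IHk f Nf pif0 m m_in.
  have [g fE [Ng pig0]] := normal_ker_divU0 Nf pif0.
  have m5 := normal_ker_U0 Nf pif0 m_in.
  have mE : (U_(inord 5) + (m - U_(inord 5)))%MM = m.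
    by rewrite addmC submK //; apply/mnm_lepP => i; rewrite mnm1E; case: eqP => // <-.
  have := IHk g Ng pig0 (m - U_(inord 5))%MM.
  rewrite mcoeff_msupp -(mcoeffMX g U_(inord 5)) -[_ * _]fE mE -mcoeff_msupp m_in.
  by rewrite mnmBE mnm1E eqxx => /(_ isT); lia.
case E : (msupp f) => [|m s] // _.
(* Dividing once more than the exponent of [U0] in [m] allows gives the contradiction. *)
have := U0_ge (m (inord 5)).+1 m; rewrite E mem_head ltnn => /(_ isT); by [].
Qed.

End WithC1.
End Toric.

(** The quotients [d1 / d2] and its [star] image are encoded by their defining equations, whose
    solutions are unique because [d2] and [star d2] are nonzero. *)
Theorem theorem4p1 (F : finFieldType) (c1 c1s : P4 F) :
  c1 * d2 F = d1 F ->
  c1s * star (d2 F) = star (d1 F) ->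
  forall f : S7 F, pi_map c1 c1s f = 0 <-> in_rel_ideal f.
Proof.
move=> c1E c1sE f; split; last exact: pi_ideal.
move=> pif0; have [g Ng Ifg] := normalizable_all f.
have := pi_ideal c1E c1sE Ifg.
rewrite /pi_map rmorphB /= -!/(pi_map _ _ _) pif0 sub0r => /eqP.
rewrite oppr_eq0 => /eqP /(normal_ker c1E c1sE Ng) g0.
by rewrite g0 subr0 in Ifg.
Qed.
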